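(* Let $\mathcal{H}$ be a finite family of connected graphs. (i) There exists a constant $c(\mathcal{H})$ with $\mathrm{ispc}(G)\le c(\mathcal{H})$ for every connected $\mathcal{H}$-free graph $G$ if and only if $\mathcal{H}\le\{K_n,K_{1,n},F^{(1)}_n,F^{(2)}_n\}$ for some integer $n\ge4$. (ii) There exists a constant $c(\mathcal{H})$ with $\mathrm{ispp}(G)\le c(\mathcal{H})$ for every connected $\mathcal{H}$-free graph $G$ if and only if $\mathcal{H}\le\{K_n,K_{1,n},F^{(1)}_n,F^{(2)}_n,F^{(4)}_n,F^{(5)}_n\}$ for some integer $n\ge4$.
   Context: Graphs are finite and simple. $G$ is $\mathcal{H}$-free if it has no induced subgraph isomorphic to a member of $\mathcal{H}$. $\mathcal{H}_1\le\mathcal{H}_2$ means every member of $\mathcal{H}_2$ contains an induced subgraph isomorphic to some member of $\mathcal{H}_1$. A path $P$ in $G$ is isometric if it is a shortest path in $G$ between its endvertices. An isometric path cover of $G$ is a family of isometric paths of $G$ whose vertex sets cover $V(G)$; an isometric path partition is one with pairwise vertex-disjoint members. $\mathrm{ispc}(G)$, $\mathrm{ispp}(G)$ are the minimum cardinalities of an isometric path cover and partition. $K_n$: complete graph of order $n$; $K_{1,n}$: star of order $n+1$. With $A=\{x_i,y_i,z_i:1\le i\le n\}$: $F^{(1)}_n$: vertices $A\setminus\{x_i:3\le i\le n\}$, edges $x_1x_2,x_1y_1,x_1z_1$, $y_iy_{i+1},z_iz_{i+1}$ ($1\le i\le n-1$). $F^{(2)}_n$: vertices $A\setminus\{x_i:2\le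 i\le n\}$, edges $x_1y_1,x_1z_1,y_1z_1$, $y_iy_{i+1},z_iz_{i+1}$ ($1\le i\le n-1$). $F^{(4)}_n$: vertices $\{x_1,x_2\}\cup\{y_i,z_i:1\le i\le n\}$, edges $x_1y_1,x_1z_1,x_2y_1,x_2z_1$, $y_iy_{i+1},z_iz_{i+1}$ ($1\le i\le n-1$). $F^{(5)}_n$: $F^{(4)}_n$ plus the edge $x_1x_2$. *)

(* Defs.v *)
From mathcomp Require Import all_boot.
From mathcomp Require Import boolp.
From Stdlib Require List.

Set Implicit Arguments.
Unset Strict Implicit.
Unset Printing Implicit Defensive.

Record sgraph := SGraph {
  vertex :> finType;
  edge : rel vertex;
  edge_sym : symmetric edge;
  edge_irr : irreflexive edge
}.

Definition connected (G : sgraph) : Prop :=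
  0 < #|G| /\ forall x y : G, connect (@edge G) x y.

Section Induced.
Variables (G : sgraph) (S : {set G}).
Definition induced_edge : rel {x : G | x \in S} :=
  fun x y => edge (val x) (val y).
Lemma induced_sym : symmetric induced_edge.
Proof. by move=> x y; apply: edge_sym. Qed.
Lemma induced_irr : irreflexive induced_edge.
Proof. by move=> x; apply: edge_irr. Qed.
Definition induced : sgraph := SGraph induced_sym induced_irr.
End Induced.

Definition isomorphic (G H : sgraph) : Prop :=
  exists f : G -> H,
    bijective f /\ forall x y : G, edge (f x) (f y) = edge x y.

Definition contains_induced (G F : sgraph) : Prop :=
  exists S : {set G}, isomorphic (induced S) F.

Definition free (HH : seq sgraph) (G : sgraph) : Prop :=
  forall F, List.In F HH -> ~ contains_induced G F.

Definition family_le (H1 H2 : seq sgraph) : Prop :=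
  forall F2, List.In F2 H2 -> exists F1, List.In F1 H1 /\ contains_induced F2 F1.

Section IsometricPaths.
Variable G : sgraph.

(* A path is given by the sequence of its vertices; a single vertex is a path. *)
Definition path_between (x y : G) (s : seq G) : bool :=
  if s is a :: p then
    [&& a == x, last a p == y, path (@edge G) a p & uniq s]
  else false.

Definition isometric (s : seq G) : Prop :=
  exists x y : G,
    path_between x y s /\
    forall t : seq G, path_between x y t -> size s <= size t.

Definition isometric_path_cover (P : seq (seq G)) : Prop :=
  (forall s, s \in P -> isometric s) /\
  (forall v : G, exists s, s \in P /\ v \in s).

Definition isometric_path_partition (P : seq (seq G)) : Prop :=
  isometric_path_cover P /\
  pairwise (fun s t : seq G => [disjoint s & t]) P.

Lemma isometric_singletons :
  isometric_path_partition [seq [:: v] | v <- enum G].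
Proof.
split; [split|].
- move=> _ /mapP[v _ ->]; exists v, v; split; first by rewrite /= !eqxx.
  by case.
- move=> v; exists [:: v]; split; last by rewrite mem_head.
  by apply: map_f; rewrite mem_enum.
- rewrite pairwise_map.
  apply: (sub_pairwise (r := fun x y : G => x != y)).
    by move=> x y /= xy; rewrite disjoint_has /= inE orbF.
  by rewrite -uniq_pairwise enum_uniq.
Qed.

Definition has_cover_of_size (k : nat) : bool :=
  `[< exists P, isometric_path_cover P /\ size P = k >].
Definition has_partition_of_size (k : nat) : bool :=
  `[< exists P, isometric_path_partition P /\ size P = k >].

Lemma ex_ispc : exists k, has_cover_of_size k.
Proof.
exists (size [seq [:: v] | v <- enum G]); apply/asboolP.
by eexists; split; first exact: (proj1 isometric_singletons).
Qed.
Lemma ex_ispp : exists k, has_partition_of_size k.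
Proof.
exists (size [seq [:: v] | v <- enum G]); apply/asboolP.
by eexists; split; first exact: isometric_singletons.
Qed.

Definition ispc : nat := ex_minn ex_ispc.
Definition ispp : nat := ex_minn ex_ispp.

End IsometricPaths.

(* The simple graph whose edges are the pairs listed, in either order, by e. *)
Section SymClosure.
Variables (T : finType) (e : rel T).
Definition symc_edge : rel T := fun x y => (x != y) && (e x y || e y x).
Lemma symc_sym : symmetric symc_edge.
Proof. by move=> x y; rewrite /symc_edge eq_sym orbC. Qed.
Lemma symc_irr : irreflexive symc_edge.
Proof. by move=> x; rewrite /symc_edge eqxx. Qed.
Definition symc_graph : sgraph := SGraph symc_sym symc_irr.
End SymClosure.

Definition Kn (n : nat) : sgraph := @symc_graph 'I_n (fun _ _ => true).

(* K_{1,n}: None is the centre. *)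
Definition K1n (n : nat) : sgraph :=
  @symc_graph (option 'I_n) (fun u v => ~~ isSome u && isSome v).

(* vx i, vy i, vz i stand for x_{i+1}, y_{i+1}, z_{i+1}. *)
Local Notation vx i := (inl i).
Local Notation vy i := (inr (inl i)).
Local Notation vz i := (inr (inr i)).

Definition F1 (n : nat) : sgraph :=
  @symc_graph ('I_2 + ('I_n + 'I_n))%type (fun u v =>
    match u, v with
    | vx i, vx j => (i == 0 :> nat) && (j == 1 :> nat)
    | vx i, vy j => (i == 0 :> nat) && (j == 0 :> nat)
    | vx i, vz j => (i == 0 :> nat) && (j == 0 :> nat)
    | vy i, vy j => j == i.+1 :> nat
    | vz i, vz j => j == i.+1 :> nat
    | _, _ => false
    end).

Definition F2 (n : nat) : sgraph :=
  @symc_graph ('I_1 + ('I_n + 'I_n))%type (fun u v =>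
    match u, v with
    | vx i, vy j => j == 0 :> nat
    | vx i, vz j => j == 0 :> nat
    | vy i, vz j => (i == 0 :> nat) && (j == 0 :> nat)
    | vy i, vy j => j == i.+1 :> nat
    | vz i, vz j => j == i.+1 :> nat
    | _, _ => false
    end).

Definition F4 (n : nat) : sgraph :=
  @symc_graph ('I_2 + ('I_n + 'I_n))%type (fun u v =>
    match u, v with
    | vx i, vy j => j == 0 :> nat
    | vx i, vz j => j == 0 :> nat
    | vy i, vy j => j == i.+1 :> nat
    | vz i, vz j => j == i.+1 :> nat
    | _, _ => false
    end).

Definition F5 (n : nat) : sgraph :=
  @symc_graph ('I_2 + ('I_n + 'I_n))%type (fun u v =>
    match u, v with
    | vx i, vx j => (i == 0 :> nat) && (j == 1 :> nat)
    | vx i, vy j => j == 0 :> nat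
    | vx i, vz j => j == 0 :> nat
    | vy i, vy j => j == i.+1 :> nat
    | vz i, vz j => j == i.+1 :> nat
    | _, _ => false
    end).

(* Main.v *)
Require Import Defs.
From mathcomp Require Import all_boot.
From mathcomp Require Import boolp zify.

Set Implicit Arguments.
Unset Strict Implicit.
Unset Printing Implicit Defensive.

(** Sufficiency. Excluding [K_n] and [K_{1,n}] bounds the degree, by Ramsey's
    theorem. Fix a root r; a path along which the distance to r increases is
    isometric. Let v_0 = r, v_1, ..., v_D be such a path, and let x be a vertex
    off the path, adjacent to it, at distance l from r with n < l < D - n. Then
    excluding F1 and F2 forces x to be adjacent to both v_{l-1} and v_{l+1}, so
    that x can replace v_l; excluding also F4 and F5 leaves no such x. Hence, for
    each of the boundedly many vertices a at distance n + 1 from r, the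
    descendants of a, except those in a bounded ball near the last layers, form a
    blow-up of a path with bounded parts, and boundedly many increasing paths
    cover it (a single path, when F4 and F5 are excluded).

    Necessity. Attach many vertices to a long path, far apart, each in the way
    prescribed by F1, F2, F4 or F5. Each attachment contains an end of some
    member of any cover (for F4 and F5, of any partition), so ispc (ispp) is
    large, whereas a small connected induced subgraph meets at most one
    attachment and so embeds in the corresponding F_n. *)

(** * Induced subgraphs *)

Definition embeds (F G : sgraph) : Prop :=
  exists2 f : F -> G, injective f & forall x y, edge (f x) (f y) = edge x y.

Lemma embeds_trans F G H : embeds F G -> embeds G H -> embeds F H.
Proof.
move=> [f f_inj fE] [g g_inj gE]; exists (g \o f); first exact: inj_comp.
by move=> x y /=; rewrite gE fE.
Qed.

Lemma isomorphic_embeds F G : isomorphic F G -> embeds F G.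
Proof. by move=> [f [/bij_inj f_inj fE]]; exists f. Qed.

Lemma isomorphic_sym F G : isomorphic F G -> isomorphic G F.
Proof.
move=> [f [[g fK gK] fE]]; exists g; split; first by exists f.
by move=> x y; rewrite -fE !gK.
Qed.

Lemma embeds_isomorphic F G : embeds F G -> #|G| <= #|F| -> isomorphic F G.
Proof. by move=> [f f_inj fE] cardG; exists f; split=> //; apply: inj_card_bij. Qed.

Lemma contains_inducedE F G : contains_induced G F <-> embeds F G.
Proof.
split=> [[S /isomorphic_sym/isomorphic_embeds FS] | [f f_inj fE]].
  by apply: embeds_trans FS _; exists val; first exact: val_inj.
have fS x : f x \in [set y in codom f] by rewrite inE codom_f.
exists [set y in codom f]; apply/isomorphic_sym/embeds_isomorphic.
  exists (fun x => exist _ (f x) (fS x)) => [x y [/f_inj] | x y] //.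
  exact: fE.
by rewrite card_sig cardsE card_codom.
Qed.

Lemma freeE HH G : free HH G <-> forall F, List.In F HH -> ~ embeds F G.
Proof. by split=> freeG F FH; have := freeG F FH; rewrite contains_inducedE. Qed.

Lemma free_embeds HH F G : embeds F G -> free HH G -> free HH F.
Proof.
move=> FG /freeE freeG; apply/freeE => F0 F0H F0F.
exact: freeG F0H (embeds_trans F0F FG).
Qed.

Lemma family_le_free H1 H2 G : family_le H1 H2 -> free H1 G -> free H2 G.
Proof.
move=> H12 freeG F /H12[F1 [F1H F1F]] /contains_inducedE FG.
exact: free_embeds FG freeG F1 F1H F1F.
Qed.

Lemma family_leE H1 H2 : family_le H1 H2 <-> forall F, List.In F H2 -> ~ free H1 F.
Proof.
split=> [H12 F /H12[F1 [F1H F1F]] /(_ F1 F1H) // | nfree F /nfree Fn].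
apply: contrapT => no_member; apply: Fn => F1 F1H F1F.
by apply: no_member; exists F1.
Qed.

Lemma symc_edgeE (T : finType) (e : rel T) : irreflexive e ->
  forall x y, symc_edge e x y = e x y || e y x.
Proof.
by move=> e_irr x y; rewrite /symc_edge; have [->|] //= := eqVneq x y; rewrite e_irr.
Qed.

Lemma connected_from (G : sgraph) (r : G) :
  (forall x, connect (@edge G) r x) -> connected G.
Proof.
move=> rc; split=> [|x y]; first by apply/card_gt0P; exists r.
by apply: connect_trans (rc y); rewrite (sym_connect_sym (@edge_sym G)).
Qed.

Section Lipschitz.
Variables (G : sgraph) (h : G -> nat).
Hypothesis h_lip : forall x y, edge x y -> h y <= (h x).+1.

Lemma path_lipschitz x p : path (@edge G) x p -> h (last x p) <= h x + size p.
Proof.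
elim: p x => [|y p IHp] x /=; first by rewrite addn0.
by move=> /andP[/h_lip xy /IHp/leq_trans-> //]; rewrite addnS -addSn leq_add2r.
Qed.

Lemma connected_lipschitz x y : connected G -> h y < h x + #|G|.
Proof.
move=> [_ /(_ x y)/connectP[_ /shortenP[p p_path p_uniq _] ->]].
apply: leq_ltn_trans (path_lipschitz p_path) _.
by rewrite ltn_add2l -[_ < _]/(size (x :: p) <= _) -(card_uniqP p_uniq) max_card.
Qed.

End Lipschitz.

(** * Ramsey's theorem and bounded degree *)

Section Ramsey.
Variables (T : finType) (e : rel T).
Hypothesis e_sym : symmetric e.

Definition homogeneous (c : bool) (B : {set T}) :=
  {in B &, forall u v, u != v -> e u v = c}.

Lemma homogeneousU1 c x (B : {set T}) :
  homogeneous c B -> {in B, forall y, e x y = c} -> homogeneous c (x |: B).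
Proof.
move=> hB xB u v; rewrite !inE => /predU1P[->|uB] /predU1P[->|vB].
- by rewrite eqxx.
- by move=> _; apply: xB.
- by move=> _; rewrite e_sym; apply: xB.
- exact: hB.
Qed.

Lemma ramsey (m : bool -> nat) (A : {set T}) : 2 ^ (m true + m false) <= #|A| ->
  exists c (B : {set T}), [/\ B \subset A, #|B| = m c & homogeneous c B].
Proof.
have [k] := ubnP (m true + m false); elim: k => // k IHk in m A *.
rewrite ltnS => m_le cardA.
have [[c mc0]|m_gt0] : (exists c, m c = 0) \/ (0 < m true /\ 0 < m false).
- case mt: (m true) => [|?]; first by left; exists true.
  by case mf: (m false) => [|?]; [left; exists false | right].
- by exists c, set0; rewrite sub0set cards0 mc0; split=> // u v; rewrite inE.
have /card_gt0P[x xA] : 0 < #|A| by apply: leq_trans cardA; rewrite expn_gt0.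
pose N c := [set y in A :\ x | e x y == c].
have [c cardN] : exists c, 2 ^ (m true + m false).-1 <= #|N c|.
  have cardE : #|A| = (#|N true| + #|N false|).+1.
    rewrite (cardsD1 x) xA add1n -(cardsID [set y | e x y] (A :\ x)); congr (_ + _).+1.
      by apply: eq_card => y; rewrite !inE eqb_id.
    by apply: eq_card => y; rewrite !inE andbC eqbF_neg.
  have : 2 ^ (m true + m false) = 2 * 2 ^ (m true + m false).-1.
    by rewrite -expnS prednK //; lia.
  have [|] := leqP (2 ^ (m true + m false).-1) #|N true|; first by exists true.
  by exists false; lia.
have [||b [B [BN cardB hB]]] := IHk (fun b => m b - (b == c)) (N c).
- by case: (c) => /=; lia.
- by apply: leq_trans cardN; rewrite leq_exp2l //; case: (c) => /=; lia.
have NA : N c \subset A by apply/subsetP=> y; rewrite !inE => /andP[/andP[]].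
have [bc|bc] := eqVneq b c; last first.
  by exists b, B; rewrite (subset_trans BN) // cardB (negPf bc) subn0.
have xN y : y \in B -> (y != x) && (e x y == c).
  by move=> /(subsetP BN); rewrite !inE -andbA => /and3P[-> _ ->].
exists c, (x |: B); split.
- by rewrite subUset sub1set xA (subset_trans BN).
- have xB : x \notin B by apply/negP=> /xN; rewrite eqxx.
  by rewrite cardsU1 xB cardB bc eqxx; case: (c); lia.
- by apply: homogeneousU1 => [|y /xN/andP[_ /eqP]//]; rewrite -bc.
Qed.

End Ramsey.

Definition nbhd (G : sgraph) (x : G) : {set G} := [set y | edge x y].

Lemma clique_embeds (G : sgraph) (B : {set G}) :
  homogeneous (@edge G) true B -> embeds (Kn #|B|) G.
Proof.
move=> hB; exists enum_val => [|i j]; first exact: enum_val_inj.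
rewrite /= /symc_edge andbT; have [->|ij] := eqVneq i j; first exact: edge_irr.
by rewrite hB ?enum_valP // (inj_eq enum_val_inj).
Qed.

Lemma star_embeds (G : sgraph) (x : G) (B : {set G}) :
  B \subset nbhd x -> homogeneous (@edge G) false B -> embeds (K1n #|B|) G.
Proof.
move=> /subsetP BN hB.
have xB (i : 'I_#|B|) : edge x (enum_val i).
  by have := BN _ (enum_valP i); rewrite inE.
exists (oapp enum_val x).
  move=> [i|] [j|] //= => [/enum_val_inj-> // | ix | jx].
    by have := xB i; rewrite ix edge_irr.
  by have := xB j; rewrite -jx edge_irr.
move=> [i|] [j|]; rewrite /= symc_edgeE ?edge_irr ?xB ?[edge _ x]edge_sym ?xB //;
  try by case.
have [->|ij] := eqVneq i j; first exact: edge_irr.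
by rewrite hB ?enum_valP // (inj_eq enum_val_inj).
Qed.

Lemma card_nbhd_lt (G : sgraph) n (x : G) :
  ~ embeds (Kn n) G -> ~ embeds (K1n n) G -> #|nbhd x| < 2 ^ (n + n).
Proof.
move=> noKn noK1n; rewrite ltnNge; apply/negP=> nbhd_large.
have [[] [B [BN cardB hB]]] := ramsey (@edge_sym G) (m := fun=> n) nbhd_large.
  by apply: noKn; rewrite -cardB; apply: clique_embeds.
by apply: noK1n; rewrite -cardB; apply: star_embeds BN hB.
Qed.

(** * Paths with attached vertices *)

(* [pre], [mid] and [post] tell whether a vertex attached to a path at position
   [p] is adjacent to the path vertices [p - 1], [p] and [p + 1]. *)
Definition attached (pre mid post : bool) (p j : nat) : bool :=
  [|| pre && (j.+1 == p), mid && (j == p) | post && (j == p.+1)].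

Definition comb_arc L (I : finType) (pos : I -> nat) pre mid post :
    rel ('I_L + I)%type := fun u v =>
  match u, v with
  | inl j, inl k => k == j.+1 :> nat
  | inl j, inr i => attached pre mid post (pos i) j
  | _, _ => false
  end.

Definition comb L (I : finType) (pos : I -> nat) pre mid post : sgraph :=
  symc_graph (@comb_arc L I pos pre mid post).

Definition fork L p pre mid post : sgraph :=
  @comb L unit (fun=> p) pre mid post.

Lemma comb_edgeE L (I : finType) (pos : I -> nat) pre mid post
    (u v : comb L pos pre mid post) :
  edge u v = comb_arc pos pre mid post u v || comb_arc pos pre mid post v u.
Proof. by rewrite /= symc_edgeE // => -[j|i] //=; lia. Qed.

(* The path is z_n, ..., z_1, x_1, y_1, ..., y_n; the attached vertex is x_2. *)
Definition fork_vertex n pre mid post (u : 'I_2 + ('I_n + 'I_n)) :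
    fork (n + n.+1) n pre mid post :=
  match u with
  | inl i => if i == 0 :> nat then inl (rshift n ord0) else inr tt
  | inr (inl k) => inl (rshift n (lift ord0 k))
  | inr (inr k) => inl (lshift n.+1 (rev_ord k))
  end.

Lemma isomorphic_fork n pre mid post (e : rel ('I_2 + ('I_n + 'I_n))) :
  irreflexive e ->
  (forall u v, edge (fork_vertex pre mid post u) (fork_vertex pre mid post v) =
     e u v || e v u) ->
  isomorphic (symc_graph e) (fork (n + n.+1) n pre mid post).
Proof.
move=> e_irr eE; apply: embeds_isomorphic; last first.
  by rewrite !card_sum !card_ord card_unit; lia.
exists (@fork_vertex n pre mid post) => [|u v]; last by rewrite eE /= symc_edgeE.
pose code (w : fork (n + n.+1) n pre mid post) : nat :=
  if w is inl j then j else n + n.+1.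
move=> [[[|[|i]] ?]|[[i ?]|[i ?]]] [[[|[|j]] ?]|[[j ?]|[j ?]]] //
    /(congr1 code); rewrite /code /= ?/bump /= => ij; try (exfalso; lia);
  by repeat congr inr; repeat congr inl; apply: ord_inj => /=; lia.
Qed.

Local Ltac fork_edges :=
  apply: isomorphic_fork => [[i|[i|i]] /= | ]; try lia;
  move=> [[[|[|i]] ?]|[[i ?]|[i ?]]] [[[|[|j]] ?]|[[j ?]|[j ?]]];
  by rewrite comb_edgeE //= /attached /= ?/bump; lia.

Lemma F1_fork n : isomorphic (F1 n) (fork (n + n.+1) n false true false).
Proof. fork_edges. Qed.

Lemma F4_fork n : isomorphic (F4 n) (fork (n + n.+1) n true false true).
Proof. fork_edges. Qed.

Lemma F5_fork n : isomorphic (F5 n) (fork (n + n.+1) n true true true).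
Proof. fork_edges. Qed.

(* The path is z_n, ..., z_1, y_1, ..., y_n; the attached vertex is x_1. *)
Definition even_fork_vertex n (u : 'I_1 + ('I_n + 'I_n)) :
    fork (n + n) n.-1 false true true :=
  match u with
  | inl _ => inr tt
  | inr (inl k) => inl (rshift n k)
  | inr (inr k) => inl (lshift n (rev_ord k))
  end.

Lemma F2_fork n : isomorphic (F2 n) (fork (n + n) n.-1 false true true).
Proof.
apply: embeds_isomorphic; last by rewrite !card_sum !card_ord card_unit; lia.
exists (@even_fork_vertex n).
  pose code (w : fork (n + n) n.-1 false true true) : nat :=
    if w is inl j then j else n + n.
  move=> [i|[[i ?]|[i ?]]] [j|[[j ?]|[j ?]]] // /(congr1 code);
    rewrite /code /= => ij; try (exfalso; lia);
    by [congr inl; rewrite !ord1 | repeat congr inr; repeat congr inl;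
        apply: ord_inj => /=; lia].
move=> u v; rewrite comb_edgeE /= symc_edgeE; last by case=> [i|[i|i]] /=; lia.
case: u v => [i|[[i ?]|[i ?]]] [j|[[j ?]|[j ?]]] //=;
  by rewrite /attached /=; lia.
Qed.

Lemma comb_connected L (I : finType) (pos : I -> nat) pre mid post :
  0 < L -> (forall i, exists j : 'I_L, attached pre mid post (pos i) j) ->
  connected (comb L pos pre mid post).
Proof.
move=> L_gt0 site; pose origin : comb L pos pre mid post := inl (Ordinal L_gt0).
have path_connect j (jL : j < L) : connect (@edge _) origin (inl (Ordinal jL)).
  elim: j jL => [|j IHj] jL; first by rewrite (bool_irrelevance jL L_gt0) connect0.
  apply: connect_trans (IHj (ltnW jL)) (connect1 _).
  by rewrite comb_edgeE /= eqxx.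
apply: (connected_from (r := origin)) => -[[j jL]|i]; first exact: path_connect.
have [[j jL] ij] := site i.
by apply: connect_trans (path_connect j jL) (connect1 _); rewrite comb_edgeE /= ij.
Qed.

Definition spread (I : finType) K (pos : I -> nat) : Prop :=
  forall i j, i != j -> pos i + K <= pos j \/ pos j + K <= pos i.

Lemma spread_inj (I : finType) K (pos : I -> nat) :
  0 < K -> spread K pos -> injective pos.
Proof.
move=> K_gt0 pos_spread i j ij; apply: contraTeq K_gt0 => /pos_spread.
by rewrite ij; lia.
Qed.

Section CombWindows.
Variables (F : sgraph) (L : nat) (I : finType) (pos : I -> nat).
Variables (pre mid post : bool) (L' p : nat).
Local Notation comb := (comb L pos pre mid post).

Lemma comb_translate (f : F -> comb) q :
  0 < L' -> injective f -> (forall x y, edge (f x) (f y) = edge x y) -> injective pos ->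
  (forall x i, f x = inr i -> pos i = q) ->
  (forall x j, f x = inl j -> q <= j + p < q + L') ->
  embeds F (fork L' p pre mid post).
Proof.
move: L' => [//|L''] _ f_inj fE pos_inj fI fL.
pose g x : fork L''.+1 p pre mid post :=
  if f x is inl j then inl (inord (j + p - q)) else inr tt.
exists g => x y; last rewrite -fE !comb_edgeE; rewrite /g;
  case fx: (f x) => [j|i]; case fy: (f y) => [k|k] //=.
- have := fL _ _ fx; have := fL _ _ fy => kq jq [] /(congr1 val).
  rewrite /= !inordK; [|lia..] => jk; apply: f_inj; rewrite fx fy.
  by congr inl; apply: ord_inj; lia.
- by move=> _; apply: f_inj; rewrite fx fy (pos_inj i k) // (fI _ _ fx) (fI _ _ fy).
- have := fL _ _ fx; have := fL _ _ fy => kq jq.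
  by rewrite !inordK; lia.
- by have := fL _ _ fx => jq; rewrite inordK /attached ?(fI _ _ fy); lia.
- by have := fL _ _ fy => kq; rewrite inordK /attached ?(fI _ _ fx); lia.
Qed.

(* The attached vertices are far apart, so a connected subgraph of order at most
   [K] contains at most one of them. *)
Lemma comb_embeds_fork K :
  connected F -> #|F| <= K -> spread K pos -> K <= p.+1 -> p + K <= L' ->
  embeds F comb -> embeds F (fork L' p pre mid post).
Proof.
move=> Fconn FK pos_spread Kp KL [f f_inj fE]; have [F_gt0 _] := Fconn.
pose place (u : comb) := match u with inl j => j : nat | inr i => pos i end.
have near x y : place (f y) < place (f x) + K.
  apply: leq_trans (_ : place (f x) + #|F| <= _); last by rewrite leq_add2l.
  apply: (connected_lipschitz (h := place \o f)) Fconn => u v.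
  by rewrite -fE comb_edgeE /=; case: (f u) (f v) => [j|i] [k|l];
    rewrite /= /attached; lia.
have [x0 x0P] : exists x0, forall x i, f x = inr i -> pos i = place (f x0).
  have [[x0 [i0 fx0]]|none] := pselect (exists x0 i0, f x0 = inr i0); last first.
    have /card_gt0P[x0 _] := F_gt0; exists x0 => x i fx.
    by case: none; exists x, i.
  exists x0 => x i fx; rewrite fx0; have [->//|/pos_spread] := eqVneq i i0.
  by have := near x x0; have := near x0 x; rewrite fx fx0 /=; lia.
have K_gt0 := leq_trans F_gt0 FK; have L'_gt0 : 0 < L' by lia.
apply: (comb_translate L'_gt0 f_inj fE (spread_inj K_gt0 pos_spread) x0P) => x j fx.
by have := near x x0; have := near x0 x; rewrite fx /=; lia.
Qed.

End CombWindows.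

Lemma comb_free HH n L (I : finType) (pos : I -> nat) pre mid post L' p :
  (forall F, List.In F HH -> connected F /\ #|F| <= n) -> spread n pos ->
  n <= p.+1 -> p + n <= L' -> free HH (fork L' p pre mid post) ->
  free HH (comb L pos pre mid post).
Proof.
move=> HHn pos_spread np nL /freeE fork_free; apply/freeE => F FH.
have [Fconn Fn] := HHn F FH; apply: contra_not (fork_free F FH).
exact: comb_embeds_fork Fconn Fn pos_spread np nL.
Qed.

(** * Distance *)

Lemma card_bigcup_le (I T : finType) (A : {set I}) (B : I -> {set T}) m :
  (forall i, i \in A -> #|B i| <= m) -> #|\bigcup_(i in A) B i| <= #|A| * m.
Proof.
move=> Bm; rewrite -sum_nat_const.
elim/big_rec2: _ => [|i k U iA IH]; first by rewrite cards0.
by rewrite (leq_trans (leq_card_setU _ _)) // leq_add ?Bm.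
Qed.

Section Distance.
Variable G : sgraph.

Definition ball k (x : G) : {set G} :=
  iter k (fun A => A :|: \bigcup_(y in A) nbhd y) [set x].

Lemma ballS k x y z : y \in ball k x -> edge y z -> z \in ball k.+1 x.
Proof.
move=> yB yz; rewrite inE; apply/orP; right.
by apply/bigcupP; exists y; rewrite // inE.
Qed.

Lemma sub_ball k l x : k <= l -> ball k x \subset ball l x.
Proof.
move=> /subnK <-; elim: (l - k) => // m IHm.
exact: subset_trans IHm (subsetUl _ _).
Qed.

Lemma card_ball M k x : (forall y : G, #|nbhd y| < M) -> #|ball k x| <= M ^ k.
Proof.
move=> nbhd_lt; elim: k => [|k IHk]; first by rewrite cards1.
rewrite expnS mulnC; apply: leq_trans (leq_mul IHk (leqnn M)).
apply: leq_trans (_ : #|\bigcup_(y in ball k x) (y |: nbhd y)| <= _).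
  rewrite /= subset_leq_card // subUset; apply/andP; split; apply/subsetP => y.
    by move=> yB; apply/bigcupP; exists y; rewrite ?setU11.
  by move=> /bigcupP[z zB yz]; apply/bigcupP; exists z; rewrite // setU1r.
apply: card_bigcup_le => y _; apply: leq_trans (nbhd_lt y).
by rewrite cardsU1 inE edge_irr.
Qed.

Hypothesis Gconn : connected G.

Lemma ball_exhausts x y : exists k, y \in ball k x.
Proof.
have [_ /(_ x y)/connectP[p p_path ->]] := Gconn.
elim/last_ind: p p_path => [_|p z IHp]; first by exists 0; rewrite inE.
rewrite rcons_path last_rcons => /andP[/IHp[k lB] lz].
by exists k.+1; apply: ballS lB lz.
Qed.

Definition dist (x y : G) : nat := ex_minn (ball_exhausts x y).

Lemma mem_ball k x y : (y \in ball k x) = (dist x y <= k).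
Proof.
rewrite /dist; case: ex_minnP => m yB m_min; apply/idP/idP => [/m_min //|mk].
exact: subsetP (sub_ball x mk) y yB.
Qed.

Lemma distxx x : dist x x = 0.
Proof. by apply/eqP; rewrite -leqn0 -mem_ball inE. Qed.

Lemma dist_eq0 x y : (dist x y == 0) = (x == y).
Proof. by rewrite -leqn0 -mem_ball inE eq_sym. Qed.

Lemma dist_edge x y z : edge y z -> dist x z <= (dist x y).+1.
Proof. by rewrite -mem_ball; apply: ballS; rewrite mem_ball. Qed.

Lemma dist_parent x y : 0 < dist x y ->
  exists2 z, edge z y & dist x y = (dist x z).+1.
Proof.
case dxy: (dist x y) => [//|k] _.
have : y \in ball k.+1 x by rewrite mem_ball dxy.
rewrite inE mem_ball dxy ltnn /= => /bigcupP[z]; rewrite mem_ball inE => zk zy.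
by exists z => //; have := dist_edge x zy; lia.
Qed.

End Distance.

(** * Families of sequences *)

Definition ends (T : Type) (s : seq T) : seq T :=
  if s is x :: p then [:: x; last x p] else [::].

Lemma interior_infix (T : eqType) (s : seq T) v : v \in s -> v \notin ends s ->
  exists u w, infix [:: u; v; w] s.
Proof.
move=> /splitPr[s1 [|w s2]]; first case: s1 => [|y s1];
  rewrite /= ?last_cat ?mem_head ?inE ?eqxx ?orbT //.
case/lastP: s1 => [|s1 u]; rewrite /= ?mem_head // => _.
by exists u, w; apply/infixP; exists s1, s2; rewrite cat_rcons.
Qed.

Lemma index_infix3 (T : eqType) (s : seq T) u v w :
  uniq s -> infix [:: u; v; w] s ->
  index v s = (index u s).+1 /\ index w s = (index u s).+2.
Proof.
move=> s_uniq /infixP[s1 [s2 sE]]; move: s_uniq; rewrite {s}sE.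
rewrite cat_uniq /= !inE !negb_or.
move=> /and3P[_ /and4P[u1 v1 w1 _] /and4P[/and3P[uv uw _] /andP[vw _] _ _]].
rewrite !index_cat (negPf u1) (negPf v1) (negPf w1) /= !eqxx.
by rewrite (negPf uv) (negPf uw) (negPf vw) !addnS addn0.
Qed.

Definition pairwise_disjoint (T : finType) (P : seq (seq T)) : bool :=
  pairwise (fun s t : seq T => [disjoint s & t]) P.

Lemma pairwise_disjoint_eq (T : finType) (P : seq (seq T)) s t x :
  pairwise_disjoint P ->
  s \in P -> t \in P -> x \in s -> x \in t -> s = t.
Proof.
pose eq_or_disjoint := fun s t : seq T => (s == t) || [disjoint s & t].
move=> P_disj sP tP xs xt; apply/eqP; suff : eq_or_disjoint s t.
  by case/orP=> //; rewrite disjoint_has => /hasPn/(_ x xs); rewrite xt.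
have : pairwise eq_or_disjoint P.
  by apply: sub_pairwise P_disj => u v /= uv; rewrite /eq_or_disjoint uv orbT.
rewrite pairwise_all2rel => [/allrelP/(_ s t sP tP) // | u | u v].
  by rewrite /eq_or_disjoint eqxx.
by rewrite /eq_or_disjoint eq_sym disjoint_sym.
Qed.

Lemma card_le_ends (I T : finType) (gadget : I -> {set T}) (P : seq (seq T)) :
  (forall i j x, x \in gadget i -> x \in gadget j -> i = j) ->
  (forall i, exists2 x, x \in gadget i & x \in flatten (map (@ends T) P)) ->
  #|I| <= (size P).*2.
Proof.
move=> gadget_disj /fin_all_exists2[e e_gadget e_ends].
have e_inj : injective e.
  move=> i j eij; have := e_gadget i; rewrite eij.
  by move/gadget_disj; apply; apply: e_gadget.
have : size (flatten (map (@ends T) P)) <= (size P).*2.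
  by elim: (P) => //= s Q IHQ; rewrite size_cat doubleS; case: s => [|x s] /=; lia.
apply: leq_trans; rewrite cardE -(size_map e) uniq_leq_size //.
  by rewrite map_inj_uniq // enum_uniq.
by move=> _ /mapP[i _ ->].
Qed.

(** * Isometric paths *)

Section Isometric.
Variable G : sgraph.

Lemma isometric_consP (x : G) p : isometric (x :: p) <->
  path (@edge G) x p /\
  forall q, path (@edge G) x q -> last x q = last x p -> size p <= size q.
Proof.
split=> [[_ [_ [/and4P[/eqP<- /eqP<- p_path _] p_min]]] | [p_path p_min]].
  split=> // q; case/shortenP => q' q'_path q'_uniq q'q lastE.
  have := p_min (x :: q'); rewrite /path_between lastE !eqxx q'_path q'_uniq.
  move=> /(_ isT) p_size; apply: leq_trans (p_size : size p <= size q') _.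
  by apply: uniq_leq_size => //; case/andP: q'_uniq.
exists x, (last x p); split=> [|[|_ q] //= /and4P[/eqP-> /eqP lastE q_path _]];
  last exact: p_min.
rewrite /= !eqxx p_path -/(uniq (x :: p)); have := p_min.
case/shortenP: p_path => p' p'_path p'_uniq p'p /(_ p' p'_path erefl) p'_size.
apply: (leq_size_uniq p'_uniq) => // y.
by rewrite !inE => /predU1P[->|/p'p ->]; rewrite ?eqxx ?orbT.
Qed.

Lemma isometric1 (x : G) : isometric [:: x].
Proof. by apply/isometric_consP. Qed.

Lemma isometric_uniq (s : seq G) : isometric s -> uniq s.
Proof. by case: s => [//|x p] [y [z [/and4P[]]]]. Qed.

Lemma isometric_infix3 (s : seq G) u v w : isometric s -> infix [:: u; v; w] s ->
  [/\ u != w, edge v u, edge v w & ~~ edge u w].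
Proof.
move=> s_iso uvw; have uw : u != w.
  by have := infix_uniq uvw (isometric_uniq s_iso); rewrite /= !inE => /andP[/norP[]].
case/infixP: uvw => [[|x s1] [s2 sE]]; rewrite {s}sE /= in s_iso.
  move/isometric_consP: s_iso => [/and3P[uv vw s2_path] s_min].
  rewrite edge_sym; split=> //; apply/negP => e_uw.
  by have := s_min (w :: s2); rewrite /= e_uw ltnn => /(_ s2_path erefl).
move/isometric_consP: s_iso; rewrite cat_path last_cat /=.
move=> [/and5P[s1_path s1u uv vw s2_path] s_min].
rewrite edge_sym; split=> //; apply/negP => e_uw.
have := s_min (s1 ++ [:: u, w & s2]).
rewrite cat_path last_cat /= s1_path s1u e_uw s2_path => /(_ isT erefl).
by rewrite !size_cat /= !addnS ltnn.
Qed.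

End Isometric.

(** * Covers and partitions *)

Section CoverNumbers.
Variable G : sgraph.

Lemma ispc_cover : exists2 P : seq (seq G), isometric_path_cover P & size P = ispc G.
Proof. by rewrite /ispc; case: ex_minnP => _ /asboolP[P [P_cover <-]] _; exists P. Qed.

Lemma ispp_partition :
  exists2 P : seq (seq G), isometric_path_partition P & size P = ispp G.
Proof. by rewrite /ispp; case: ex_minnP => _ /asboolP[P [P_part <-]] _; exists P. Qed.

Lemma ispc_le_size (P : seq (seq G)) : isometric_path_cover P -> ispc G <= size P.
Proof.
by move=> ?; rewrite /ispc; case: ex_minnP => k _; apply; apply/asboolP; exists P.
Qed.

Lemma ispp_le_size (P : seq (seq G)) : isometric_path_partition P -> ispp G <= size P.
Proof.
by move=> ?; rewrite /ispp; case: ex_minnP => k _; apply; apply/asboolP; exists P.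
Qed.

Lemma ispc_le_ispp : ispc G <= ispp G.
Proof. by have [P [P_cover _] <-] := ispp_partition; apply: ispc_le_size. Qed.

Definition add_singletons (P : seq (seq G)) : seq (seq G) :=
  P ++ [seq [:: x] | x <- enum [predC flatten P]].

Lemma size_add_singletons (P : seq (seq G)) :
  size (add_singletons P) = size P + #|[predC flatten P]|.
Proof. by rewrite size_cat size_map -cardE. Qed.

Lemma add_singletons_cover (P : seq (seq G)) :
  {in P, forall s, isometric s} -> isometric_path_cover (add_singletons P).
Proof.
move=> P_iso; split=> [s | x].
  rewrite mem_cat => /orP[/P_iso // | /mapP[x _ ->]]; exact: isometric1.
have [/flattenP[s sP xs] | xP] := boolP (x \in flatten P).
  by exists s; rewrite mem_cat sP.
exists [:: x]; rewrite mem_head mem_cat; split=> //; apply/orP; right.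
by apply: map_f; rewrite mem_enum.
Qed.

Lemma add_singletons_partition (P : seq (seq G)) :
  {in P, forall s, isometric s} ->
  pairwise_disjoint P ->
  isometric_path_partition (add_singletons P).
Proof.
move=> P_iso P_disj; split; first exact: add_singletons_cover.
rewrite pairwise_cat -/(pairwise_disjoint P) P_disj; apply/andP; split.
  apply/allrelP=> s _ sP /mapP[x + ->]; rewrite mem_enum disjoint_sym disjoint_has.
  by rewrite /= orbF inE; apply: contra => xs; apply/flattenP; exists s.
rewrite pairwise_map; have := enum_uniq [predC flatten P].
rewrite uniq_pairwise; apply: sub_pairwise => x y /= xy.
by rewrite disjoint_has /= inE orbF.
Qed.

Lemma ispc_le_add_uncovered (P : seq (seq G)) : {in P, forall s, isometric s} ->
  ispc G <= size P + #|[predC flatten P]|.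
Proof.
by move=> P_iso; rewrite -size_add_singletons; apply/ispc_le_size/add_singletons_cover.
Qed.

Lemma ispp_le_add_uncovered (P : seq (seq G)) : {in P, forall s, isometric s} ->
  pairwise_disjoint P ->
  ispp G <= size P + #|[predC flatten P]|.
Proof.
move=> P_iso P_disj; rewrite -size_add_singletons.
exact/ispp_le_size/add_singletons_partition.
Qed.

End CoverNumbers.

(** * Lower bounds *)

Section ForcedEnds.
Variable G : sgraph.

Definition simplicial_off (l r v : G) : Prop :=
  forall u w, u != w -> edge v u -> edge v w -> ~~ edge u w ->
  (u = l /\ w = r) \/ (u = r /\ w = l).

Definition simplicial (v : G) : Prop :=
  forall u w, u != w -> edge v u -> edge v w -> edge u w.

Lemma simplicial_end (s : seq G) v :
  isometric s -> v \in s -> simplicial v -> v \in ends s.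
Proof.
move=> s_iso vs v_simp; apply/negPn/negP => /(interior_infix vs)[u [w uvw]].
have [uw vu vw /negP] := isometric_infix3 s_iso uvw; apply.
exact: v_simp.
Qed.

Lemma card_simplicial_le (I : finType) (f : I -> G) :
  injective f -> (forall i, simplicial (f i)) -> #|I| <= (ispc G).*2.
Proof.
move=> f_inj f_simp; have [P [P_iso P_cover] <-] := ispc_cover G.
apply: (card_le_ends (gadget := fun i => [set f i])) => [i j x | i].
  by rewrite !inE => /eqP-> /eqP/f_inj.
exists (f i); first exact: set11.
have [s [sP fs]] := P_cover (f i); apply/flatten_mapP; exists s => //.
exact: simplicial_end (P_iso s sP) fs (f_simp i).
Qed.

Lemma simplicial_off_interior (l r v : G) (s : seq G) :
  simplicial_off l r v -> isometric s -> v \in s -> v \notin ends s ->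
  infix [:: l; v; r] s \/ infix [:: r; v; l] s.
Proof.
move=> v_off s_iso vs /(interior_infix vs)[u [w uvw]].
have [uw vu vw nuw] := isometric_infix3 s_iso uvw.
by case: (v_off u w uw vu vw nuw) => -[<- <-]; [left | right].
Qed.

(* Otherwise the paths through [x] and [y] both contain [l] and [r], hence are
   equal, and both [x] and [y] lie between [l] and [r] there. *)
Lemma twins_end (P : seq (seq G)) (l r x y : G) :
  isometric_path_partition P -> x != y ->
  simplicial_off l r x -> simplicial_off l r y ->
  exists2 v, v \in [set x; y] & v \in flatten (map (@ends G) P).
Proof.
move=> [[P_iso P_cover] P_disj] xy x_off y_off; apply: contrapT => no_end.
have interior v s : v \in [set x; y] -> s \in P -> v \notin ends s.
  move=> vxy sP; apply/negP => v_end; apply: no_end.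
  by exists v => //; apply/flatten_mapP; exists s.
have [s [sP xs]] := P_cover x; have [t [tP yt]] := P_cover y.
have s_lr :=
  simplicial_off_interior x_off (P_iso s sP) xs (interior x s (set21 x y) sP).
have t_lr :=
  simplicial_off_interior y_off (P_iso t tP) yt (interior y t (set22 x y) tP).
have ls : l \in s by case: s_lr => /mem_infix; apply; rewrite !inE eqxx ?orbT.
have lt : l \in t by case: t_lr => /mem_infix; apply; rewrite !inE eqxx ?orbT.
have s_uniq := isometric_uniq (P_iso s sP).
have st := pairwise_disjoint_eq P_disj sP tP ls lt; rewrite -{}st in t_lr yt.
have x_index : index x s = minn (index l s) (index r s) + 1.
  by case: s_lr => /(index_infix3 s_uniq)[]; lia.
have y_index : index y s = minn (index l s) (index r s) + 1.
  by case: t_lr => /(index_infix3 s_uniq)[]; lia.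
by case/eqP: xy; rewrite -(nth_index x xs) -(nth_index x yt) x_index y_index.
Qed.

End ForcedEnds.

Lemma Kn_simplicial n (v : Kn n) : simplicial v.
Proof. by move=> u w uw _ _; rewrite /= /symc_edge uw. Qed.

Lemma Kn_connected n : 0 < n -> connected (Kn n).
Proof.
case: n => // n _; apply: (connected_from (r := ord0 : Kn n.+1)) => x.
have [->|x0] := eqVneq x (ord0 : Kn n.+1); first exact: connect0.
by apply: connect1; rewrite /= /symc_edge eq_sym x0.
Qed.

Lemma Kn_ispc n : n <= (ispc (Kn n)).*2.
Proof.
by have := card_simplicial_le (@inj_id (Kn n)) (@Kn_simplicial n); rewrite card_ord.
Qed.

Lemma K1n_connected n : connected (K1n n).
Proof.
apply: (connected_from (r := None : K1n n)) => -[i|]; last exact: connect0.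
exact: connect1.
Qed.

Lemma K1n_simplicial n (i : 'I_n) : simplicial (Some i : K1n n).
Proof. by move=> [j|] [k|] //; rewrite /= /symc_edge ?andbF. Qed.

Lemma K1n_ispc n : n <= (ispc (K1n n)).*2.
Proof.
have Some_inj : injective (Some : 'I_n -> K1n n) by move=> i j [].
by have := card_simplicial_le Some_inj (@K1n_simplicial n); rewrite card_ord.
Qed.

Lemma comb_simplicial L (I : finType) (pos : I -> nat) mid post (i : I) :
  simplicial (inr i : comb L pos false mid post).
Proof.
move=> [j|j] [k|k] //; rewrite !comb_edgeE //= /attached => jk.
by have {}jk : j != k by []; move: jk; rewrite -val_eqE /=; lia.
Qed.

Lemma comb_ispc L (I : finType) (pos : I -> nat) mid post :
  #|I| <= (ispc (comb L pos false mid post)).*2.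
Proof.
apply: (card_simplicial_le (f := inr : I -> comb L pos false mid post)).
  by move=> i j [].
exact: comb_simplicial.
Qed.

Section CombTwins.
Variables (L : nat) (I : finType) (pos : I -> nat) (mid : bool).
Hypothesis pos_spread : spread 2 pos.
Hypothesis pos_range : forall i, 0 < pos i /\ (pos i).+1 < L.
Local Notation comb := (comb L pos true mid true).

Lemma attached_spread i j : attached true mid true (pos i) (pos j) -> i = j.
Proof.
by rewrite /attached; have [//|/pos_spread] := eqVneq i j; lia.
Qed.

Section Site.
Variables (i : I) (l c r : 'I_L).
Hypotheses (c_pos : c = pos i :> nat) (c_l : c = l.+1 :> nat) (r_c : r = c.+1 :> nat).

Lemma path_vertices_eq (j k : 'I_L) :
  (j = l :> nat /\ k = r :> nat) \/ (j = r :> nat /\ k = l :> nat) ->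
  ((inl j : comb) = inl l /\ (inl k : comb) = inl r) \/
  ((inl j : comb) = inl r /\ (inl k : comb) = inl l).
Proof. by case=> -[/ord_inj-> /ord_inj->]; [left | right]. Qed.

Lemma attached_simplicial_off : simplicial_off (inl l : comb) (inl r) (inr i).
Proof.
move=> [j|j] [k|k] jk; rewrite !comb_edgeE //= ?orbF => ij ik njk.
have {}jk : j != k by []; apply: path_vertices_eq.
by move: jk ij ik njk; rewrite -val_eqE /attached /=; lia.
Qed.

Lemma site_simplicial_off : simplicial_off (inl l : comb) (inl r) (inl c).
Proof.
move=> [j|j] [k|k] jk; rewrite !comb_edgeE //= ?orbF.
- have {}jk : j != k by []; move=> cj ck _; apply: path_vertices_eq.
  by move: jk cj ck; rewrite -val_eqE /=; lia.
- move=> cj; rewrite c_pos => /attached_spread ->.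
  by rewrite /attached; lia.
- rewrite c_pos => /attached_spread -> ck.
  by rewrite /attached; lia.
- rewrite c_pos => /attached_spread ji /attached_spread ki.
  by case/eqP: jk; rewrite ji ki.
Qed.

End Site.

Lemma comb_ispp : #|I| <= (ispp comb).*2.
Proof.
have posL i : pos i < L by have [_ /ltnW] := pos_range i.
have [P P_part <-] := ispp_partition comb.
pose gadget i : {set comb} := [set inr i; inl (Ordinal (posL i))].
apply: (card_le_ends (gadget := gadget)) => [i j x | i].
  rewrite !inE => /orP[]/eqP-> /orP[]/eqP // => [[] // |].
  by case=> /(spread_inj _ pos_spread)->.
have [pos_gt0 posSL] := pos_range i.
have predL : (pos i).-1 < L by rewrite prednK // ltnW.
apply: (twins_end (l := inl (Ordinal predL) : comb) (r := inl (Ordinal posSL)) P_part).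
- by [].
- by apply: (attached_simplicial_off (c := Ordinal (posL i))); rewrite //= prednK.
- by apply: (site_simplicial_off (i := i)); rewrite //= prednK.
Qed.

End CombTwins.

(** * Upper bounds *)

Lemma layered_path_cover (T : finType) (e : rel T) (S : nat -> {set T}) k M :
  (forall i, i <= k -> 0 < #|S i| <= M) ->
  (forall i, i < k -> {in S i & S i.+1, forall x y, e x y}) ->
  exists P : seq (seq T), [/\ size P = M,
    forall s, s \in P -> size s = k.+1 /\ sorted e s &
    forall x, x \in flatten P <-> exists2 i, i <= k & x \in S i].
Proof.
move=> cardS eS; have /card_gt0P[x0 _] : 0 < #|S 0| by case/andP: (cardS 0 isT).
pose pick t i := nth (head x0 (enum (S i))) (enum (S i)) t.
have pickS t i : i <= k -> pick t i \in S i.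
  move=> /cardS/andP[Si_gt0 _]; rewrite /pick -mem_enum.
  have [tS|tS] := ltnP t (size (enum (S i))); first exact: mem_nth.
  rewrite nth_default //; move: Si_gt0; rewrite cardE.
  by case: (enum (S i)) => //= y s _; apply: mem_head.
exists [seq mkseq (pick t) k.+1 | t <- iota 0 M]; split.
- by rewrite size_map size_iota.
- move=> _ /mapP[t _ ->]; rewrite size_mkseq; split=> //.
  apply/(sortedP x0) => i; rewrite size_mkseq ltnS => ik.
  rewrite !nth_mkseq; [|lia..].
  by apply: (eS i ik); apply: pickS => //; apply: ltnW.
- move=> x; split=> [/flatten_mapP[t _ /mapP[i + ->]] | [i ik xS]].
    by rewrite mem_iota ltnS => ik; exists i; rewrite ?pickS.
  apply/flatten_mapP; exists (index x (enum (S i))).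
    have [_ Si_le] := andP (cardS i ik); rewrite mem_iota.
    by apply: leq_trans Si_le; rewrite cardE index_mem mem_enum.
  apply/mapP; exists i; first by rewrite mem_iota ltnS.
  by rewrite /pick nth_index ?mem_enum.
Qed.

Section RootedGraph.
Variables (G : sgraph) (Gconn : connected G) (r : G).
Local Notation depth := (dist Gconn r).

Definition child : rel G := [rel x y | edge x y && (depth y == (depth x).+1)].

Lemma depth_edge x y : edge x y -> depth y <= (depth x).+1 /\ depth x <= (depth y).+1.
Proof. by move=> xy; split; apply: dist_edge; rewrite // edge_sym. Qed.

Lemma child_path_depth x p : path child x p -> depth (last x p) = depth x + size p.
Proof.
elim: p x => [|y p IHp] x /=; first by rewrite addn0.
by move=> /andP[/andP[_ /eqP dy] /IHp->]; rewrite dy addSnnS.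
Qed.

Lemma child_sorted_isometric s : s != [::] -> sorted child s -> isometric s.
Proof.
case: s => //= x p _ xp; apply/isometric_consP; split.
  by apply: sub_path xp => u v /andP[].
move=> q /(path_lipschitz (@dist_edge _ Gconn r)) + qE.
by rewrite qE child_path_depth // leq_add2l.
Qed.

Lemma descendant_depth x y : connect child x y -> depth x <= depth y.
Proof. by move=> /connectP[p /child_path_depth pE ->]; rewrite pE leq_addr. Qed.

Lemma descendant_eq x y : connect child x y -> depth y <= depth x -> y = x.
Proof. by move=> /connectP[[|z p] /child_path_depth pE ->] //; rewrite pE /=; lia. Qed.

Lemma descendant_dist z x y : connect child x y ->
  dist Gconn z y <= dist Gconn z x + (depth y - depth x).
Proof.
move=> /connectP[p p_child ->]; rewrite child_path_depth // addKn.
apply: path_lipschitz (@dist_edge _ Gconn z) _ _ _.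
by apply: sub_path p_child => u v /andP[].
Qed.

Lemma descendant_parent x y : connect child x y -> depth x < depth y ->
  exists2 z, connect child x z & child z y.
Proof.
move=> /connectP[p]; case/lastP: p => [_ -> | p z]; first by rewrite ltnn.
rewrite rcons_path last_rcons => /andP[p_child lz] -> _.
by exists (last x p) => //; apply/connectP; exists p.
Qed.

Lemma descendant_between x y k : connect child x y -> depth x <= k <= depth y ->
  exists z, [/\ connect child x z, connect child z y & depth z = k].
Proof.
move=> xy /andP[xk ky]; have [m ym] := ubnP (depth y - k).
elim: m => // m IHm in y xy ky ym *.
have [ky'|ky'] := eqVneq (depth y) k; first by exists y; rewrite xy connect0.
have [|z xz zy] := descendant_parent xy; first lia.
have /andP[_ /eqP dy] := zy.
have [|//|t [xt tz dt]] := IHm z xz; try lia.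
by exists t; split=> //; apply: connect_trans tz (connect1 zy).
Qed.

Lemma root_descendant y : connect child r y.
Proof.
have [m ym] := ubnP (depth y); elim: m => // m IHm in y ym *.
have [d0|/dist_parent[z zy dy]] := posnP (depth y).
  by move/eqP: d0; rewrite dist_eq0 => /eqP->; apply: connect0.
by apply: connect_trans (IHm z _) (connect1 _); rewrite ?/child /= ?zy ?dy //; lia.
Qed.

Lemma ancestor y k : k <= depth y -> exists2 x, depth x = k & connect child x y.
Proof.
move=> ky; have [|x [_ xy dx]] := descendant_between (k := k) (root_descendant y).
  by rewrite distxx.
by exists x.
Qed.

Definition geodesic D (v : nat -> G) : Prop :=
  (forall i, i <= D -> depth (v i) = i) /\ (forall i, i < D -> edge (v i) (v i.+1)).

Lemma geodesic_edge D v i j : geodesic D v -> i <= D -> j <= D ->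
  edge (v i) (v j) = (j == i.+1) || (i == j.+1).
Proof.
move=> [v_depth v_edge] iD jD.
have [jE|ji] := eqVneq j i.+1; first by rewrite jE; apply: v_edge; lia.
have [iE|ij] := eqVneq i j.+1; first by rewrite iE edge_sym v_edge //; lia.
apply/negP => /= e; have [] := depth_edge e; rewrite !v_depth // => le_ji le_ij.
by move: e; rewrite (_ : i = j) ?edge_irr; lia.
Qed.

Lemma geodesic_through a w : connect child a w ->
  exists2 v, geodesic (depth w) v & v (depth a) = a.
Proof.
have /connectP[p p_child aE] := root_descendant a; move=> /connectP[q q_child wE].
have pa : depth a = size p by rewrite aE child_path_depth // distxx.
have pq_child : path child r (p ++ q) by rewrite cat_path p_child -aE.
have wE' : w = last r (p ++ q) by rewrite last_cat -aE.
have dw : depth w = size (p ++ q) by rewrite wE' child_path_depth // distxx.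
exists (nth r (r :: p ++ q)); last first.
  by rewrite pa -cat_cons nth_cat /= ltnS leqnn (nth_last r (r :: p)) /= -aE.
have step i : i < depth w -> child (nth r (r :: p ++ q) i) (nth r (r :: p ++ q) i.+1).
  by move=> iw; apply: (pathP r pq_child); rewrite -dw.
split=> i iw; last by case/andP: (step i iw).
elim: i iw => [|i IHi] iw; first exact: distxx.
by have /andP[_ /eqP->] := step i iw; rewrite IHi // ltnW.
Qed.

Lemma geodesic_descendant D v i j : geodesic D v -> i <= j <= D ->
  connect child (v i) (v j).
Proof.
move=> [v_depth v_edge] /andP[/subnKC <-]; elim: (j - i) => [|k IHk] kD.
  by rewrite addn0 connect0.
rewrite addnS in kD *; apply: connect_trans (IHk (ltnW kD)) (connect1 _).
by rewrite /child /= v_edge // !v_depth ?eqxx // ltnW.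
Qed.

Definition bottom a := \max_(w in connect child a) depth w.

Lemma descendant_bottom a x : connect child a x -> depth x <= bottom a.
Proof. exact: (@leq_bigmax_cond _ (mem (connect child a)) depth). Qed.

Definition spine a (v : nat -> G) : Prop := geodesic (bottom a) v /\ v (depth a) = a.

Lemma spine_exists a : exists v, spine a v.
Proof.
rewrite /spine /bottom; have [|w aw ->] := @eq_bigmax_cond _ (connect child a) depth.
  by apply/card_gt0P; exists a; apply: connect0.
by have [v v_geo va] := geodesic_through aw; exists v.
Qed.

Definition exchange (v : nat -> G) (x : G) (i : nat) : G :=
  if i == depth x then x else v i.

Lemma exchange_depth v x : exchange v x (depth x) = x.
Proof. by rewrite /exchange eqxx. Qed.

Lemma exchange_neq v x i : i != depth x -> exchange v x i = v i.
Proof. by rewrite /exchange => /negPf->. Qed.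

Lemma exchange_pred D v x : geodesic D (exchange v x) -> 0 < depth x <= D ->
  edge x (v (depth x).-1).
Proof.
move=> [_ w_edge] /andP[x_gt0 xD].
rewrite edge_sym -{2}(exchange_depth v x) -(@exchange_neq v x); last lia.
by rewrite -{2}(prednK x_gt0) w_edge // prednK.
Qed.

Lemma exchange_succ D v x : geodesic D (exchange v x) -> depth x < D ->
  edge x (v (depth x).+1).
Proof.
move=> [_ w_edge] xD.
by rewrite -{1}(exchange_depth v x) -(@exchange_neq v x) ?w_edge //; lia.
Qed.

Lemma geodesic_exchange D v x : geodesic D v -> 0 < depth x ->
  edge x (v (depth x).-1) -> edge x (v (depth x).+1) -> geodesic D (exchange v x).
Proof.
move=> [v_depth v_edge] x_gt0 x_pred x_succ.
split=> i iD; rewrite /exchange; first by case: eqP => // _; apply: v_depth.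
case: eqP => [->|_]; first by rewrite gtn_eqF.
by case: eqP => [ix|_]; [rewrite -ix edge_sym in x_pred | exact: v_edge].
Qed.

Lemma geodesic_exchange_id D v x : geodesic D v -> x = v (depth x) ->
  geodesic D (exchange v x).
Proof.
move=> [v_depth v_edge] xv; have vE i : exchange v x i = v i.
  by rewrite /exchange; case: eqP => // ->.
by split=> i iD; rewrite !vE; [apply: v_depth | apply: v_edge].
Qed.

Definition attachment (v : nat -> G) (x : G) : pred nat :=
  attached (edge x (v (depth x).-1)) (edge x (v (depth x)))
           (edge x (v (depth x).+1)) (depth x).

Section Attachment.
Variables (D : nat) (v : nat -> G) (x : G).
Hypotheses (v_geo : geodesic D v) (x_gt0 : 0 < depth x).

Lemma edge_geodesic i : i <= D -> edge x (v i) = attachment v x i.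
Proof.
move=> iD; rewrite /attachment /attached.
have [ix|ix] := eqVneq i (depth x).-1.
  by rewrite ix prednK // eqxx andbT !ltn_eqF ?andbF ?orbF //; lia.
have [->|ix'] := eqVneq i (depth x).
  by rewrite !andbT gtn_eqF ?ltn_eqF ?andbF ?orbF.
have [->|ix''] := eqVneq i (depth x).+1.
  by rewrite !andbT gtn_eqF ?andbF //; lia.
rewrite !andbF orbF; have [|_] := eqVneq i.+1 (depth x); first lia.
by rewrite andbF; apply/negP => /depth_edge; rewrite (proj1 v_geo) //; lia.
Qed.

Lemma geodesic_fork_embeds L p pre mid post q :
  x != v (depth x) -> q + L <= D.+1 ->
  (forall j, j < L -> attached pre mid post p j = attachment v x (q + j)) ->
  embeds (fork L p pre mid post) G.
Proof.
move=> xv qL attE; have v_depth := proj1 v_geo.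
have v_inj i j : i <= D -> j <= D -> v i = v j -> i = j.
  by move=> iD jD vij; rewrite -(v_depth i iD) vij v_depth.
have v_x i : i <= D -> v i <> x.
  by move=> /v_depth vi ix; rewrite -ix vi eqxx in xv.
have qD (j : 'I_L) : q + j <= D by have := ltn_ord j; lia.
exists (fun u : fork L p pre mid post => if u is inl j then v (q + j) else x).
  move=> [i|[]] [j|[]] //=.
  - by move=> /v_inj ij; congr inl; apply/ord_inj/(@addnI q)/ij.
  - by move/v_x; case.
  - by move/esym/v_x; case.
move=> [i|[]] [j|[]]; rewrite comb_edgeE /= ?orbF ?edge_irr //.
- by rewrite (geodesic_edge v_geo) //; lia.
- by rewrite edge_sym edge_geodesic ?attE.
- by rewrite edge_geodesic ?attE.
Qed.

End Attachment.

Section NoForks.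
Variable n : nat.
Hypotheses (noF1 : ~ embeds (F1 n) G) (noF2 : ~ embeds (F2 n) G).

(* If [x] misses one of the two vertices of [v] just before and after its own
   depth, then [x] and a window of [v] around it induce [F1 n] or [F2 n]. *)
Lemma adjacent_exchange D v x i : geodesic D v -> n < depth x -> depth x + n < D ->
  i <= D -> edge x (v i) -> geodesic D (exchange v x).
Proof.
move=> v_geo x_deep xD iD xi.
have x_gt0 : 0 < depth x := leq_ltn_trans (leq0n n) x_deep.
have [|xv] := eqVneq x (v (depth x)); first exact: geodesic_exchange_id.
suff [] : edge x (v (depth x).-1) /\ edge x (v (depth x).+1).
  exact: geodesic_exchange.
have no_fork1 : ~ embeds (fork (n + n.+1) n false true false) G.
  apply: contra_not noF1; apply: embeds_trans; exact/isomorphic_embeds/F1_fork.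
have no_fork2 : ~ embeds (fork (n + n) n.-1 false true true) G.
  apply: contra_not noF2; apply: embeds_trans; exact/isomorphic_embeds/F2_fork.
have embed L p pre mid post q :=
  @geodesic_fork_embeds D v x v_geo x_gt0 L p pre mid post q xv.
have := edge_geodesic v_geo x_gt0 iD; rewrite {}xi /attachment in embed *.
case: (edge x (v (depth x).-1)) (edge x (v (depth x))) (edge x (v (depth x).+1)) embed
  => [] [] [] embed xi //; exfalso.
- by case: no_fork2; apply: (embed _ _ _ _ _ (depth x - n)) => [|j jn];
    rewrite /attached; lia.
- by case: no_fork1; apply: (embed _ _ _ _ _ (depth x - n.+1)) => [|j jn];
    rewrite /attached; lia.
- by case: no_fork2; apply: (embed _ _ _ _ _ (depth x - n.-1)) => [|j jn];
    rewrite /attached; lia.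
- by case: no_fork1; apply: (embed _ _ _ _ _ (depth x - n)) => [|j jn];
    rewrite /attached; lia.
- by case: no_fork1; apply: (embed _ _ _ _ _ ((depth x).+1 - n)) => [|j jn];
    rewrite /attached; lia.
Qed.

Lemma adjacent_unique D v x i : ~ embeds (F4 n) G -> ~ embeds (F5 n) G ->
  geodesic D v -> n < depth x -> depth x + n < D ->
  i <= D -> edge x (v i) -> x = v (depth x).
Proof.
move=> noF4 noF5 v_geo x_deep xD iD xi.
have x_gt0 : 0 < depth x := leq_ltn_trans (leq0n n) x_deep.
apply: contrapT => /eqP xv.
have w_geo := adjacent_exchange v_geo x_deep xD iD xi.
have x_pred : edge x (v (depth x).-1) by apply: (exchange_pred w_geo); lia.
have x_succ : edge x (v (depth x).+1) by apply: (exchange_succ w_geo); lia.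
have embed L p pre mid post q :=
  @geodesic_fork_embeds D v x v_geo x_gt0 L p pre mid post q xv.
rewrite /attachment x_pred x_succ in embed; case: (edge x _) embed => embed.
- apply: noF5; apply: embeds_trans (isomorphic_embeds (F5_fork n)) _.
  by apply: (embed _ _ _ _ _ (depth x - n)) => [|j jn]; rewrite /attached; lia.
- apply: noF4; apply: embeds_trans (isomorphic_embeds (F4_fork n)) _.
  by apply: (embed _ _ _ _ _ (depth x - n)) => [|j jn]; rewrite /attached; lia.
Qed.

(* The maximum keeps [a] in its trunk even if all its descendants are close to
   the bottom. *)
Definition trunk_depth a : nat := maxn (depth a) (bottom a - n.+1).

Definition trunk a : {set G} := [set x | connect child a x & depth x <= trunk_depth a].

Lemma depth_trunk_depth a : depth a <= trunk_depth a <= bottom a.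
Proof.
by rewrite leq_maxl geq_max leq_subr (descendant_bottom (connect0 child a)).
Qed.

Lemma mem_trunk_depth a x : x \in trunk a -> depth a <= depth x <= trunk_depth a.
Proof. by rewrite inE => /andP[/descendant_depth -> ->]. Qed.

Lemma trunk_inner a x : x \in trunk a -> x != a ->
  depth a < depth x /\ depth x + n < bottom a.
Proof.
rewrite inE /trunk_depth => /andP[ax x_top] xa; have := descendant_depth ax.
rewrite leq_eqVlt => /predU1P[dax|]; last lia.
by case/eqP: xa; apply: descendant_eq ax _; rewrite dax.
Qed.

Lemma mem_trunk_spine a v i : spine a v ->
  depth a <= i <= trunk_depth a -> v i \in trunk a.
Proof.
move=> [v_geo va] /andP[ai iE]; have /andP[_ ED] := depth_trunk_depth a.
have iD := leq_trans iE ED; rewrite inE (proj1 v_geo) // iE andbT.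
by rewrite -{1}va (geodesic_descendant v_geo) // ai.
Qed.

Section Trunk.
Variable a : G.
Hypothesis a_deep : n < depth a.

(* The parent [y] of [x] can be exchanged for the path vertex at its depth, so
   that [x] is adjacent to a geodesic; the vertex following [x] in it is on [v]
   again. *)
Lemma trunk_exchange v x :
  spine a v -> x \in trunk a -> geodesic (bottom a) (exchange v x).
Proof.
move=> [v_geo va]; have [k] := ubnP (depth x); elim: k => // k IHk in x *.
rewrite ltnS => xk xT; have [xa|xa] := eqVneq x a.
  by apply: geodesic_exchange_id; rewrite // xa va.
have [ax xD] := trunk_inner xT xa; have x_deep := ltn_trans a_deep ax.
have [y ay /andP[yx /eqP dx]] : exists2 y, connect child a y & child y x.
  by apply: descendant_parent => //; move: xT; rewrite inE => /andP[].
have w_geo : geodesic (bottom a) (exchange v y).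
  by apply: IHk; rewrite ?inE ?ay /=; have := mem_trunk_depth xT; lia.
have xy : edge x (exchange v y (depth y)) by rewrite exchange_depth edge_sym.
have x_succ : edge x (exchange v y (depth x).+1).
  by apply: (exchange_succ (adjacent_exchange w_geo x_deep xD _ xy)); lia.
by apply: (adjacent_exchange v_geo x_deep xD _ (i := (depth x).+1));
  rewrite -?(@exchange_neq v y); lia.
Qed.

Lemma trunk_child x y : x \in trunk a -> y \in trunk a ->
  depth y = (depth x).+1 -> child x y.
Proof.
move=> xT yT dy; have [v v_spine] := spine_exists a.
have /andP[ax _] := mem_trunk_depth xT.
have [|ay yD] := trunk_inner yT.
  by apply: contraTneq ax => ya; rewrite -ltnNge -ya dy.
have w_geo := trunk_exchange v_spine xT.
have y_succ : edge y (exchange v x (depth y).+1).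
  rewrite exchange_neq; last lia.
  by apply: (exchange_succ (trunk_exchange v_spine yT)); lia.
have y_geo : geodesic (bottom a) (exchange (exchange v x) y).
  by apply: (adjacent_exchange w_geo _ yD _ y_succ); lia.
have := exchange_pred y_geo; rewrite dy /= exchange_depth edge_sym => xy.
by rewrite /child /= dy eqxx xy //; lia.
Qed.

Lemma card_trunk_layer M j : (forall x : G, #|nbhd x| < M) ->
  #|[set x in trunk a | depth x == j]| <= M.
Proof.
move=> nbhd_lt; have [v v_spine] := spine_exists a.
apply: leq_trans (ltnW (nbhd_lt (v j.-1))); apply/subset_leq_card/subsetP => x.
rewrite [x \in nbhd _]inE inE => /andP[xT /eqP <-]; rewrite edge_sym.
apply: (exchange_pred (trunk_exchange v_spine xT)).
by have := mem_trunk_depth xT; have := depth_trunk_depth a; lia.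
Qed.

Lemma trunk_path_cover M : (forall j, #|[set x in trunk a | depth x == j]| <= M) ->
  exists P : seq (seq G), [/\ size P = M, {in P, forall s, isometric s}
    & flatten P =i trunk a].
Proof.
move=> cardM; have [v v_spine] := spine_exists a.
pose S i := [set x in trunk a | depth x == depth a + i].
have /andP[aE ED] := depth_trunk_depth a.
have [i ik|i ik x y|P [P_size P_sorted P_flat]] :=
    @layered_path_cover _ child S (trunk_depth a - depth a) M.
- rewrite cardM andbT; apply/card_gt0P; exists (v (depth a + i)).
  rewrite inE mem_trunk_spine //=; last lia.
  by apply/eqP/(proj1 (proj1 v_spine)); lia.
- rewrite inE => /andP[xT /eqP dx]; rewrite inE => /andP[yT /eqP dy].
  by apply: trunk_child => //; lia.
exists P; split=> // [s /P_sorted[s_size s_child] | x].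
  by apply: child_sorted_isometric s_child; case: s s_size.
apply/idP/idP => [/P_flat[i _]|xT]; first by rewrite inE => /andP[].
have /andP[ax xE] := mem_trunk_depth xT.
by apply/P_flat; exists (depth x - depth a); rewrite ?leq_sub2r // inE xT /= subnKC.
Qed.

(* Take for [z] the last trunk vertex of a spine: it and the ancestor of [x] in
   the last layer of the trunk have a common neighbour in the layer before. *)
Lemma trunk_tail : exists z, forall x, connect child a x -> x \notin trunk a ->
  dist Gconn z x <= n.+3.
Proof.
have [v v_spine] := spine_exists a; have [v_geo _] := v_spine.
have /andP[aE ED] := depth_trunk_depth a.
exists (v (trunk_depth a)) => x ax; rewrite inE ax -ltnNge => xE.
have xD := descendant_bottom ax.
have [|y [ay yx dy]] := descendant_between (k := trunk_depth a) ax; first lia.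
have yT : y \in trunk a by rewrite inE ay dy leqnn.
have y_pred : edge (v (trunk_depth a).-1) y.
  by rewrite -dy edge_sym (exchange_pred (trunk_exchange v_spine yT)) // dy; lia.
have z_pred : edge (v (trunk_depth a)) (v (trunk_depth a).-1).
  by rewrite (geodesic_edge v_geo); lia.
have := dist_edge Gconn (v (trunk_depth a)) z_pred; rewrite distxx => pred_near.
have y_near := dist_edge Gconn (v (trunk_depth a)) y_pred.
have := descendant_dist (v (trunk_depth a)) yx.
have : bottom a - trunk_depth a <= n.+1 by rewrite /trunk_depth; lia.
by rewrite dy; lia.
Qed.

End Trunk.

Section NoTwins.
Hypotheses (noF4 : ~ embeds (F4 n) G) (noF5 : ~ embeds (F5 n) G).

Lemma trunk_unique a v x : n < depth a -> spine a v -> x \in trunk a -> x = v (depth x).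
Proof.
move=> a_deep v_spine xT; have [v_geo va] := v_spine.
have [->|xa] := eqVneq x a; first by rewrite va.
have [ax xD] := trunk_inner xT xa.
apply: (adjacent_unique noF4 noF5 v_geo _ xD (i := (depth x).+1)); try lia.
by apply: (exchange_succ (trunk_exchange a_deep v_spine xT)); lia.
Qed.

Lemma trunk_isometric a : n < depth a -> exists2 s, isometric s & s =i trunk a.
Proof.
move=> a_deep; have [v v_spine] := spine_exists a.
have [j|[|s [|t P]] [// _ P_iso P_trunk]] := @trunk_path_cover a a_deep 1.
  rewrite -(cards1 (v j)); apply/subset_leq_card/subsetP => x; rewrite inE.
  by move=> /andP[/(trunk_unique a_deep v_spine) xv /eqP <-]; rewrite inE -xv.
exists s; first by apply: P_iso; rewrite mem_head.
by move=> x; rewrite -P_trunk /= cats0.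
Qed.

(* The parent of a trunk vertex is adjacent to the spine, hence on it. *)
Lemma trunk_root a b x : n < depth a -> depth b = depth a ->
  x \in trunk a -> connect child b x -> b = a.
Proof.
move=> a_deep dba; have [v v_spine] := spine_exists a; have [v_geo _] := v_spine.
have [k] := ubnP (depth x); elim: k => // k IHk in x *; rewrite ltnS => xk xT bx.
have [xa|xa] := eqVneq x a.
  by rewrite -xa (descendant_eq bx) // xa dba.
have [ax xD] := trunk_inner xT xa.
have [|y yb /andP[yx /eqP dx]] := descendant_parent bx; first by rewrite dba.
have yv : y = v (depth y).
  apply: (adjacent_unique noF4 noF5 v_geo _ _ (i := depth x)); try lia.
  by rewrite -(trunk_unique a_deep v_spine xT).
apply: (IHk y) => //; first lia.
by rewrite yv mem_trunk_spine //; have := mem_trunk_depth xT; lia.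
Qed.

End NoTwins.

Section BoundedDegree.
Variable M : nat.
Hypothesis nbhd_lt : forall x : G, #|nbhd x| < M.

Definition trunk_roots : {set G} := [set a | depth a == n.+1].

Lemma card_trunk_roots : #|trunk_roots| <= M ^ n.+1.
Proof.
apply: leq_trans (card_ball n.+1 r nbhd_lt); apply/subset_leq_card/subsetP => a.
by rewrite inE (mem_ball Gconn) => /eqP->.
Qed.

Lemma card_uncovered (P : seq (seq G)) :
  {in trunk_roots, forall a, {subset trunk a <= flatten P}} ->
  #|[predC flatten P]| <= M ^ n + M ^ n.+1 * M ^ n.+3.
Proof.
move=> P_trunk.
have /fin_all_exists[z z_near] a : exists z, a \in trunk_roots ->
    forall x, connect child a x -> x \notin trunk a -> dist Gconn z x <= n.+3.
  have [|aR] := boolP (a \in trunk_roots); last by exists a.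
  rewrite inE => /eqP da; have [|z] := @trunk_tail a; first by rewrite da.
  by exists z.
pose tails := \bigcup_(a in trunk_roots) ball n.+3 (z a).
apply: leq_trans (_ : #|ball n r :|: tails| <= _).
  apply/subset_leq_card/subsetP => x; rewrite !inE (mem_ball Gconn) => xP.
  have [//|x_deep] := leqP (depth x) n; have [a da ax] := ancestor x_deep.
  have aR : a \in trunk_roots by rewrite inE da.
  apply/bigcupP; exists a => //; rewrite (mem_ball Gconn) z_near //.
  exact: contra (P_trunk a aR x) xP.
apply: leq_trans (leq_card_setU _ _) (leq_add (card_ball n r nbhd_lt) _).
apply: leq_trans (leq_mul card_trunk_roots (leqnn _)).
by apply: card_bigcup_le => a _; apply: card_ball.
Qed.

Lemma ispc_le_bound : ispc G <= M ^ n.+1 * M + (M ^ n + M ^ n.+1 * M ^ n.+3).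
Proof.
have /fin_all_exists[P P_spec] a : exists P : seq (seq G), a \in trunk_roots ->
    [/\ size P = M, {in P, forall s, isometric s} & flatten P =i trunk a].
  have [|aR] := boolP (a \in trunk_roots); last by exists [::].
  rewrite inE => /eqP da; have a_deep : n < depth a by rewrite da.
  have layers_le j := card_trunk_layer a_deep j nbhd_lt.
  by have [P P_spec] := trunk_path_cover a_deep layers_le; exists P.
pose Q := flatten [seq P a | a <- enum trunk_roots].
have Q_size : size Q <= M ^ n.+1 * M.
  rewrite size_flatten /shape -map_comp sumnE big_map big_enum /=.
  apply: leq_trans (leq_mul card_trunk_roots (leqnn M)); rewrite -sum_nat_const.
  by apply: leq_sum => a /P_spec[->].
apply: leq_trans (ispc_le_add_uncovered (P := Q) _) (leq_add Q_size (card_uncovered _)).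
  by move=> s /flatten_mapP[a]; rewrite mem_enum => /P_spec[_ + _]; apply.
move=> a aR x; have [_ _ <-] := P_spec a aR; move=> /flattenP[s sP xs].
by apply/flattenP; exists s => //; apply/flatten_mapP; exists a; rewrite ?mem_enum.
Qed.

Lemma ispp_le_bound : ~ embeds (F4 n) G -> ~ embeds (F5 n) G ->
  ispp G <= M ^ n.+1 + (M ^ n + M ^ n.+1 * M ^ n.+3).
Proof.
move=> noF4 noF5.
have /fin_all_exists[Q Q_spec] a : exists Q : seq G, a \in trunk_roots ->
    isometric Q /\ Q =i trunk a.
  have [|aR] := boolP (a \in trunk_roots); last by exists [::].
  rewrite inE => /eqP da; have [|Q] := @trunk_isometric noF4 noF5 a.
    by rewrite da.
  by exists Q.
pose P := [seq Q a | a <- enum trunk_roots].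
have P_size : size P <= M ^ n.+1 by rewrite size_map -cardE card_trunk_roots.
apply: leq_trans (ispp_le_add_uncovered (P := P) _ _) _; last first.
- apply: (leq_add P_size (card_uncovered _)) => a aR x.
  by have [_ <-] := Q_spec a aR => xQ; apply/flatten_mapP; exists a; rewrite ?mem_enum.
- rewrite /pairwise_disjoint pairwise_map; have := enum_uniq trunk_roots.
  rewrite uniq_pairwise; apply: (@sub_in_pairwise _ (mem trunk_roots)); last first.
    by apply/allP => a; rewrite mem_enum.
  move=> a b aR bR ab; rewrite /= disjoint_has; apply: contra ab => /hasP[x].
  rewrite (proj2 (Q_spec a aR)) (proj2 (Q_spec b bR)) => xa; rewrite inE => /andP[bx _].
  rewrite !inE in aR bR; apply/eqP/esym.
  by apply: (trunk_root noF4 noF5 _ _ xa bx); rewrite (eqP aR) // (eqP bR).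
- by move=> _ /mapP[a + ->]; rewrite mem_enum => /Q_spec[].
Qed.

End BoundedDegree.
End NoForks.
End RootedGraph.

Lemma ispc_bounded n : exists c, forall G : sgraph,
  connected G -> free [:: Kn n; K1n n; F1 n; F2 n] G -> ispc G <= c.
Proof.
eexists => G Gconn /freeE Gfree; have /card_gt0P[r _] := proj1 Gconn.
apply: (ispc_le_bound Gconn r (n := n)) => [||x].
- by apply: Gfree; do 2!right; left.
- by apply: Gfree; do 3!right; left.
- by apply: (card_nbhd_lt (n := n)); apply: Gfree; [left | right; left].
Qed.

Lemma ispp_bounded n : exists c, forall G : sgraph,
  connected G -> free [:: Kn n; K1n n; F1 n; F2 n; F4 n; F5 n] G -> ispp G <= c.
Proof.
eexists => G Gconn /freeE Gfree; have /card_gt0P[r _] := proj1 Gconn.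
apply: (ispp_le_bound Gconn r (n := n)) => [||x||].
- by apply: Gfree; do 2!right; left.
- by apply: Gfree; do 3!right; left.
- by apply: (card_nbhd_lt (n := n)); apply: Gfree; [left | right; left].
- by apply: Gfree; do 4!right; left.
- by apply: Gfree; do 5!right; left.
Qed.

(** * Unavoidable families *)

Definition regular_pos n (i : 'I_n) : nat := n * i.+1.

Definition regular_comb n pre mid post : sgraph :=
  comb (n * n.+1) (@regular_pos n) pre mid post.

Lemma regular_pos_spread n : spread n (@regular_pos n).
Proof.
move=> i j; rewrite -val_eqE neq_ltn /regular_pos -!mulnSr.
by case/orP => ij; [left | right]; rewrite leq_mul2l ltnS ij orbT.
Qed.

Lemma regular_pos_range n (i : 'I_n) :
  1 < n -> 0 < regular_pos i /\ (regular_pos i).+1 < n * n.+1.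
Proof.
move=> n_gt1; have : regular_pos i <= n * n by rewrite leq_mul2l ltn_ord orbT.
by rewrite mulnSr; split; [rewrite muln_gt0 | ]; lia.
Qed.

Lemma regular_comb_connected n pre mid post :
  1 < n -> [|| pre, mid | post] -> connected (regular_comb n pre mid post).
Proof.
move=> n_gt1 some_site; apply: comb_connected => [|i]; first by rewrite muln_gt0; lia.
have [pos_gt0 posL] := regular_pos_range i n_gt1.
case/or3P: some_site => ->.
- have predL : (regular_pos i).-1 < n * n.+1 by lia.
  by exists (Ordinal predL); rewrite /attached /= prednK // eqxx.
- by exists (Ordinal (ltnW posL)); rewrite /attached /= eqxx orbT.
- by exists (Ordinal posL); rewrite /attached /= eqxx !orbT.
Qed.

Section BoundedParameter.
Variables (HH : seq sgraph) (n : nat).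
Hypothesis n_gt1 : 1 < n.
Hypothesis HHn : forall F, List.In F HH -> connected F /\ #|F| <= n.

Lemma fork_not_free (mu : sgraph -> nat) F L p pre mid post :
  (forall G, connected G -> free HH G -> (mu G).*2 < n) ->
  n <= (mu (regular_comb n pre mid post)).*2 ->
  isomorphic F (fork L p pre mid post) -> [|| pre, mid | post] ->
  n <= p.+1 -> p + n <= L -> ~ free HH F.
Proof.
move=> mu_lt + /isomorphic_sym/isomorphic_embeds F_fork some_site np nL F_free.
apply/negP; rewrite -ltnNge; apply: mu_lt; first exact: regular_comb_connected.
apply: (comb_free HHn (@regular_pos_spread n) np nL).
exact: free_embeds F_fork F_free.
Qed.

Lemma ispc_bounded_family_le :
  (forall G, connected G -> free HH G -> (ispc G).*2 < n) ->
  family_le HH [:: Kn n; K1n n; F1 n; F2 n].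
Proof.
move=> ispc_lt.
have ispc_ge mid post : n <= (ispc (regular_comb n false mid post)).*2.
  by rewrite -{1}(card_ord n) comb_ispc.
apply/family_leE => F [<-|[<-|[<-|[<-|[]]]]].
- move/(ispc_lt _ (Kn_connected (ltnW n_gt1))).
  by rewrite ltnNge Kn_ispc.
- by move/(ispc_lt _ (K1n_connected n)); rewrite ltnNge K1n_ispc.
- by apply: (fork_not_free ispc_lt (ispc_ge _ _) (F1_fork n)); lia.
- by apply: (fork_not_free ispc_lt (ispc_ge _ _) (F2_fork n)); lia.
Qed.

Lemma ispp_bounded_family_le :
  (forall G, connected G -> free HH G -> (ispp G).*2 < n) ->
  family_le HH [:: F4 n; F5 n].
Proof.
move=> ispp_lt.
have ispp_ge mid : n <= (ispp (regular_comb n true mid true)).*2.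
  rewrite -{1}(card_ord n); apply: comb_ispp => [i j /regular_pos_spread|i]; first lia.
  exact: regular_pos_range.
apply/family_leE => F [<-|[<-|[]]].
- by apply: (fork_not_free ispp_lt (ispp_ge _) (F4_fork n)); lia.
- by apply: (fork_not_free ispp_lt (ispp_ge _) (F5_fork n)); lia.
Qed.

End BoundedParameter.

Lemma card_le_bigmax_In (HH : seq sgraph) F :
  List.In F HH -> #|F| <= \max_(F0 <- HH) #|F0|.
Proof.
elim: HH => //= F0 HH IHHH; rewrite big_cons leq_max.
by case=> [->|/IHHH ->]; rewrite ?leqnn ?orbT.
Qed.

Lemma family_le_cat H1 H2 H3 :
  family_le H1 H2 -> family_le H1 H3 -> family_le H1 (H2 ++ H3).
Proof. by move=> H12 H13 F FH; case: (List.in_app_or _ _ _ FH) => [/H12|/H13]. Qed.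

Theorem theorem5p2 (HH : seq sgraph)
    (HHconn : forall F : sgraph, List.In F HH -> connected F) :
  ((exists c : nat, forall G : sgraph,
      connected G -> free HH G -> ispc G <= c) <->
   (exists n : nat, 4 <= n /\
      family_le HH [:: Kn n; K1n n; F1 n; F2 n]))
  /\
  ((exists c : nat, forall G : sgraph,
      connected G -> free HH G -> ispp G <= c) <->
   (exists n : nat, 4 <= n /\
      family_le HH [:: Kn n; K1n n; F1 n; F2 n; F4 n; F5 n])).
Proof.
pose order c := \max_(F <- HH) #|F| + c.*2 + 4.
have HHorder c F : List.In F HH -> connected F /\ #|F| <= order c.
  move=> FH; split; first exact: HHconn.
  by have := card_le_bigmax_In FH; rewrite /order; lia.
split; split.
- move=> [c ispc_le]; exists (order c); split; first by rewrite /order; lia.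
  apply: (ispc_bounded_family_le _ (HHorder c)) => [|G Gconn /(ispc_le G Gconn)];
    by rewrite /order; lia.
- move=> [n [_ HHle]]; have [c ispc_le] := ispc_bounded n; exists c => G Gconn G_free.
  exact: ispc_le Gconn (family_le_free HHle G_free).
- move=> [c ispp_le]; exists (order c); split; first by rewrite /order; lia.
  have ispp_lt G : connected G -> free HH G -> (ispp G).*2 < order c.
    by move=> Gconn /(ispp_le G Gconn); rewrite /order; lia.
  have order_gt1 : 1 < order c by rewrite /order; lia.
  apply: (family_le_cat (H2 := [:: _; _; _; _]) (H3 := [:: _; _])).
    apply: (ispc_bounded_family_le order_gt1 (HHorder c)) => G Gconn /(ispp_lt G Gconn).
    by apply: leq_ltn_trans; rewrite leq_double ispc_le_ispp.
  exact: ispp_bounded_family_le order_gt1 (HHorder c) ispp_lt.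
- move=> [n [_ HHle]]; have [c ispp_le] := ispp_bounded n; exists c => G Gconn G_free.
  exact: ispp_le Gconn (family_le_free HHle G_free).
Qed.
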